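(* Let $\mathfrak{m}$ be a finitely generated Lie algebra over a field $\mathbb{K}$ and let $i$ be a fixed natural number. Then the following are equivalent: (i) $\gamma_{i+1}(\mathfrak{m})$ is finitely generated; (ii) $\mathfrak{m}^{\otimes i+1}$ is finitely generated.
   Context: $\mathbb{K}$ is a field; Lie algebras are over $\mathbb{K}$, and ''finitely generated'' means finitely generated as a Lie algebra. The lower central series is $\gamma_1(\mathfrak{m})=\mathfrak{m}$, $\gamma_{i+1}(\mathfrak{m})=[\gamma_i(\mathfrak{m}),\mathfrak{m}]$ for $i\ge 1$. A Lie action of $\mathfrak{m}$ on $\mathfrak{n}$ is a bilinear map $(m,n)\mapsto{}^mn\in\mathfrak{n}$ with ${}^{[m,m']}n={}^m({}^{m'}n)-{}^{m'}({}^mn)$ and ${}^m[n,n']=[{}^mn,n']+[n,{}^mn']$. If $\mathfrak{m}$ and $\mathfrak{n}$ act on each other, the actions are compatible when ${}^{({}^mn)}m'=[m',{}^nm]$ and ${}^{({}^nm)}n'=[n',{}^mn]$ for all $m,m'\in\mathfrak{m}$, $n,n'\in\mathfrak{n}$. For Lie algebras $\mathfrak{m},\mathfrak{n}$ acting on each other, the non-abelian tensor product $\mathfrak{m}\otimes\mathfrak{n}$ is the Lie algebra generated by symbols $m\otimes n$ ($m\in\mathfrak{m}$, $n\in\mathfrak{n}$) subject to, for all $k\in\mathbb{K}$, $m,m'\in\mathfrak{m}$, $n,n'\in\mathfrak{n}$: $k(m\otimes n)=km\otimes n=m\otimes kn$; $(m+m')\otimes n=m\otimes n+m'\otimes n$;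 $m\otimes(n+n')=m\otimes n+m\otimes n'$; $m\otimes[n,n']={}^{n'}m\otimes n-{}^nm\otimes n'$; $[m,m']\otimes n=m\otimes{}^{m'}n-m'\otimes{}^mn$; $[m\otimes n,m'\otimes n']=-{}^nm\otimes{}^{m'}n'$. There is an induced Lie homomorphism $\nu\colon\mathfrak{m}\otimes\mathfrak{n}\to\mathfrak{n}$ with $\nu(m\otimes n)={}^mn$. When the actions of $\mathfrak{m}$ and $\mathfrak{n}$ are compatible, $\mathfrak{n}$ acts on $\mathfrak{m}\otimes\mathfrak{n}$ by ${}^{n}(m'\otimes n')={}^{n}m'\otimes n'+m'\otimes[n,n']$ and $\mathfrak{m}\otimes\mathfrak{n}$ acts on $\mathfrak{n}$ by ${}^{\omega}n=[\nu(\omega),n]$; these mutual actions are again compatible, so $(\mathfrak{m}\otimes\mathfrak{n})\otimes\mathfrak{n}$ is defined, and so on inductively. Starting from $\mathfrak{n}=\mathfrak{m}$, with $\mathfrak{m}$ acting on itself by ${}^mm'=[m,m']$, set $\mathfrak{m}^{\otimes 1}=\mathfrak{m}$, $\mathfrak{m}^{\otimes 2}=\mathfrak{m}\otimes\mathfrak{m}$ and $\mathfrak{m}^{\otimes i+1}=(\mathfrak{m}^{\otimes i})\otimes\mathfrak{m}$ for $i\ge 1$. *)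

(* Defs.v *)
From HB Require Import structures.
From mathcomp Require Import all_boot all_order all_algebra.
From mathcomp Require Import boolp classical_sets.

Set Implicit Arguments.
Unset Strict Implicit.
Unset Printing Implicit Defensive.

Import GRing.Theory.

Local Open Scope classical_set_scope.
Local Open Scope quotient_scope.
Local Open Scope ring_scope.

(* Alternating ([x, x] = 0), not merely antisymmetric, since the field may have
   characteristic 2. *)
HB.mixin Record Lmodule_isLieAlgebra (K : fieldType) (L : Type)
    of GRing.Lmodule K L := {
  bracket : L -> L -> L;
  bracket_linearl : forall y, linear (fun x => bracket x y);
  bracket_linearr : forall x, linear (bracket x);
  bracketxx : forall x, bracket x x = 0;
  bracket_jacobi : forall x y z,
    bracket x (bracket y z) + bracket y (bracket z x)
      + bracket z (bracket x y) = 0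
}.

#[short(type="lieAlgType")]
HB.structure Definition LieAlgebra (K : fieldType) :=
  { L of GRing.Lmodule K L & Lmodule_isLieAlgebra K L }.

Notation "[ 'lie' x , y ]" := (bracket x y)
  (at level 0, x, y at level 99, format "[ 'lie'  x ,  y ]") : ring_scope.

Section LieTheory.
Context {K : fieldType} {L : lieAlgType K}.
Implicit Types (x y z : L) (k : K) (A B : set L).

Lemma bracketDl x y z : [lie x + y, z] = [lie x, z] + [lie y, z].
Proof. by have := bracket_linearl z 1 x y; rewrite !scale1r. Qed.

Lemma bracketDr x y z : [lie x, y + z] = [lie x, y] + [lie x, z].
Proof. by have := bracket_linearr x 1 y z; rewrite !scale1r. Qed.

Lemma bracket0l x : [lie 0, x] = 0.
Proof. by apply: (addIr [lie 0, x]); rewrite -bracketDl !add0r. Qed.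

Lemma bracket0r x : [lie x, 0] = 0.
Proof. by apply: (addIr [lie x, 0]); rewrite -bracketDr !add0r. Qed.

Lemma bracketZl k x y : [lie k *: x, y] = k *: [lie x, y].
Proof. by have := bracket_linearl y k x 0; rewrite !addr0 bracket0l addr0. Qed.

Lemma bracketZr k x y : [lie x, k *: y] = k *: [lie x, y].
Proof. by have := bracket_linearr x k y 0; rewrite !addr0 bracket0r addr0. Qed.

Lemma bracketNl x y : [lie - x, y] = - [lie x, y].
Proof. by rewrite -scaleN1r bracketZl scaleN1r. Qed.

Lemma bracketNr x y : [lie x, - y] = - [lie x, y].
Proof. by rewrite -scaleN1r bracketZr scaleN1r. Qed.

Lemma bracketC x y : [lie x, y] = - [lie y, x].
Proof.
apply/eqP; rewrite -addr_eq0; apply/eqP.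
have := bracketxx (x + y).
by rewrite bracketDl !bracketDr !bracketxx addr0 add0r.
Qed.

Lemma bracketA x y z :
  [lie x, [lie y, z]] = [lie [lie x, y], z] + [lie y, [lie x, z]].
Proof.
apply/eqP; rewrite -subr_eq0; apply/eqP.
rewrite -[RHS](bracket_jacobi x y z) -addrA; congr (_ + _).
by rewrite opprD addrC (bracketC z x) bracketNr (bracketC z).
Qed.

Definition is_submodule A :=
  [/\ A 0, (forall x y, A x -> A y -> A (x + y))
         & (forall k x, A x -> A (k *: x))].

Definition is_lie_subalgebra A :=
  is_submodule A /\ (forall x y, A x -> A y -> A [lie x, y]).

(* The spanned subspace, not just the set of brackets. *)
Definition commutator A B : set L :=
  smallest is_submodule [set [lie x, y] | x in A & y in B].

(* Indices start at 1: gamma_ 1 = L and gamma_ i.+1 = [gamma_ i, L] for i >= 1;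
   gamma_ 0 is a junk value. *)
Fixpoint gamma_ (i : nat) : set L :=
  if i is (j.+1 as i').+1 then commutator (gamma_ i') setT else setT.

(* A is generated, as a Lie subalgebra of L, by finitely many elements; an
   algebra L is finitely generated when [set: L] is. *)
Definition finitely_generated A :=
  exists s : seq L, A = smallest is_lie_subalgebra [set` s].

End LieTheory.

Arguments gamma_ {K} L i.

Inductive lie_term (K : fieldType) (X : Type) : Type :=
| LGen of X
| LZero
| LAdd of lie_term K X & lie_term K X
| LOpp of lie_term K X
| LScale of K & lie_term K X
| LBracket of lie_term K X & lie_term K X.

Arguments LGen {K X} x.
Arguments LZero {K X}.

Declare Scope lie_term_scope.
Delimit Scope lie_term_scope with LT.
Bind Scope lie_term_scope with lie_term.
Notation "0" := LZero : lie_term_scope.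
Notation "x + y" := (LAdd x y) : lie_term_scope.
Notation "- x" := (LOpp x) : lie_term_scope.
Notation "x - y" := (LAdd x (LOpp y)) : lie_term_scope.
Notation "k *: x" := (LScale k x) : lie_term_scope.
Notation "[ 'lie' x , y ]" := (LBracket x y) : lie_term_scope.

HB.instance Definition _ (K : fieldType) (X : Type) :=
  gen_eqMixin (lie_term K X).
HB.instance Definition _ (K : fieldType) (X : Type) :=
  gen_choiceMixin (lie_term K X).

Section Presentation.
Context {K : fieldType} {X : Type}.
Variable R : lie_term K X -> lie_term K X -> Prop.

(* The least congruence containing R and the axioms of Lie K-algebras. *)
Inductive lie_eq : lie_term K X -> lie_term K X -> Prop :=
| lie_eq_refl a : lie_eq a a
| lie_eq_sym a b : lie_eq a b -> lie_eq b a
| lie_eq_trans a b c : lie_eq a b -> lie_eq b c -> lie_eq a c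
| lie_eq_add a a' b b' : lie_eq a a' -> lie_eq b b' -> lie_eq (a + b) (a' + b')
| lie_eq_opp a a' : lie_eq a a' -> lie_eq (- a) (- a')
| lie_eq_scale k a a' : lie_eq a a' -> lie_eq (k *: a) (k *: a')
| lie_eq_bracket a a' b b' :
    lie_eq a a' -> lie_eq b b' -> lie_eq [lie a, b] [lie a', b']
| lie_eq_addA a b c : lie_eq (a + (b + c)) (a + b + c)
| lie_eq_addC a b : lie_eq (a + b) (b + a)
| lie_eq_add0 a : lie_eq (0 + a) a
| lie_eq_addN a : lie_eq (- a + a) 0
| lie_eq_scaleA k l a : lie_eq (k *: (l *: a)) ((k * l)%R *: a)
| lie_eq_scale1 a : lie_eq (1%R *: a) a
| lie_eq_scaleDr k a b : lie_eq (k *: (a + b)) (k *: a + k *: b)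
| lie_eq_scaleDl k l a : lie_eq ((k + l)%R *: a) (k *: a + l *: a)
| lie_eq_bracketl k a b c :
    lie_eq [lie k *: a + b, c] (k *: [lie a, c] + [lie b, c])
| lie_eq_bracketr k a b c :
    lie_eq [lie c, k *: a + b] (k *: [lie c, a] + [lie c, b])
| lie_eq_bracketxx a : lie_eq [lie a, a] 0
| lie_eq_jacobi a b c :
    lie_eq ([lie a, [lie b, c]] + [lie b, [lie c, a]] + [lie c, [lie a, b]]) 0
| lie_eq_rel a b : R a b -> lie_eq a b.

Definition lie_eqb (a b : lie_term K X) : bool := `[< lie_eq a b >].

Lemma lie_eqb_refl : reflexive lie_eqb.
Proof. by move=> a; apply/asboolP; apply: lie_eq_refl. Qed.

Lemma lie_eqb_sym : symmetric lie_eqb.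
Proof. by move=> a b; apply/asboolP/asboolP => /lie_eq_sym. Qed.

Lemma lie_eqb_trans : transitive lie_eqb.
Proof.
move=> b a c /asboolP ab /asboolP bc; apply/asboolP.
exact: lie_eq_trans ab bc.
Qed.

Canonical lie_eqb_equiv :=
  EquivRel lie_eqb lie_eqb_refl lie_eqb_sym lie_eqb_trans.

Definition presented : Type := {eq_quot lie_eqb}.

HB.instance Definition _ := Choice.on presented.
HB.instance Definition _ := Quotient.on presented.

Definition lie_class (a : lie_term K X) : presented := \pi a.

Lemma lie_classP a b : lie_class a = lie_class b <-> lie_eq a b.
Proof.
split=> [/eqmodP/asboolP //|ab].
by apply/eqmodP/asboolP.
Qed.

Lemma lie_class_repr (q : presented) : lie_class (repr q) = q.
Proof. exact: reprK. Qed.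

Lemma lie_eq_repr a : lie_eq (repr (lie_class a)) a.
Proof. by apply/lie_classP; rewrite lie_class_repr. Qed.

Let add (p q : presented) := lie_class (repr p + repr q).
Let opp (p : presented) := lie_class (- repr p).
Let scale k (p : presented) := lie_class (k *: repr p).
Let brk (p q : presented) := lie_class [lie repr p, repr q].

Let addE a b : add (lie_class a) (lie_class b) = lie_class (a + b).
Proof. by apply/lie_classP/lie_eq_add; exact: lie_eq_repr. Qed.
Let oppE a : opp (lie_class a) = lie_class (- a).
Proof. by apply/lie_classP/lie_eq_opp; exact: lie_eq_repr. Qed.
Let scaleE k a : scale k (lie_class a) = lie_class (k *: a).
Proof. by apply/lie_classP/lie_eq_scale; exact: lie_eq_repr. Qed.
Let brkE a b : brk (lie_class a) (lie_class b) = lie_class [lie a, b].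
Proof. by apply/lie_classP/lie_eq_bracket; exact: lie_eq_repr. Qed.
Let allE (P : presented -> Prop) : (forall a, P (lie_class a)) -> forall q, P q.
Proof. by move=> Pa q; rewrite -(lie_class_repr q). Qed.

Fact presented_addA : associative add.
Proof.
elim/allE=> a; elim/allE=> b; elim/allE=> c.
rewrite !addE; apply/lie_classP; exact: lie_eq_addA.
Qed.

Fact presented_addC : commutative add.
Proof.
elim/allE=> a; elim/allE=> b; rewrite !addE; apply/lie_classP.
exact: lie_eq_addC.
Qed.

Fact presented_add0 : left_id (lie_class 0) add.
Proof.
by elim/allE=> a; rewrite !addE; apply/lie_classP; exact: lie_eq_add0.
Qed.

Fact presented_addN : left_inverse (lie_class 0) opp add.
Proof.
elim/allE=> a; rewrite oppE !addE; apply/lie_classP; exact: lie_eq_addN.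
Qed.

HB.instance Definition _ := GRing.isZmodule.Build presented
  presented_addA presented_addC presented_add0 presented_addN.

Lemma lie_class0 : lie_class 0 = 0. Proof. by []. Qed.
Lemma lie_classD a b : lie_class (a + b) = lie_class a + lie_class b.
Proof. by rewrite -addE. Qed.
Lemma lie_classN a : lie_class (- a) = - lie_class a.
Proof. by rewrite -oppE. Qed.

Fact presented_scaleA k l p : scale k (scale l p) = scale (k * l) p.
Proof.
by elim/allE: p => a; rewrite !scaleE; apply/lie_classP/lie_eq_scaleA.
Qed.

Fact presented_scale1 : left_id 1 scale.
Proof. by elim/allE=> a; rewrite scaleE; apply/lie_classP/lie_eq_scale1. Qed.

Fact presented_scaleDr : right_distributive scale +%R.
Proof.
move=> k; elim/allE=> a; elim/allE=> b.
by rewrite -lie_classD !scaleE -lie_classD; apply/lie_classP/lie_eq_scaleDr.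
Qed.

Fact presented_scaleDl p : {morph scale^~ p : k l / k + l}.
Proof.
elim/allE: p => a k l.
by rewrite !scaleE -lie_classD; apply/lie_classP/lie_eq_scaleDl.
Qed.

HB.instance Definition _ := GRing.Zmodule_isLmodule.Build K presented
  presented_scaleA presented_scale1 presented_scaleDr presented_scaleDl.

Lemma lie_classZ k a : lie_class (k *: a) = k *: lie_class a.
Proof. by rewrite -scaleE. Qed.

Fact presented_linearl p : linear (fun q => brk q p).
Proof.
move=> k; elim/allE: p => c; elim/allE=> a; elim/allE=> b.
rewrite -lie_classZ -lie_classD !brkE -lie_classZ -lie_classD.
by apply/lie_classP/lie_eq_bracketl.
Qed.

Fact presented_linearr p : linear (brk p).
Proof.
move=> k; elim/allE: p => c; elim/allE=> a; elim/allE=> b.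
rewrite -lie_classZ -lie_classD !brkE -lie_classZ -lie_classD.
by apply/lie_classP/lie_eq_bracketr.
Qed.

Fact presented_brkxx p : brk p p = 0.
Proof.
by elim/allE: p => a; rewrite brkE; apply/lie_classP/lie_eq_bracketxx.
Qed.

Fact presented_jacobi p q r :
  brk p (brk q r) + brk q (brk r p) + brk r (brk p q) = 0.
Proof.
elim/allE: p => a; elim/allE: q => b; elim/allE: r => c.
by rewrite !brkE -!lie_classD; apply/lie_classP/lie_eq_jacobi.
Qed.

HB.instance Definition _ := Lmodule_isLieAlgebra.Build K presented
  presented_linearl presented_linearr presented_brkxx presented_jacobi.

Lemma lie_class_bracket a b :
  lie_class [lie a, b] = [lie lie_class a, lie_class b]%R.
Proof. by rewrite -brkE. Qed.

Lemma presented_ind (P : presented -> Prop) :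
    (forall x, P (lie_class (LGen x))) -> P 0 ->
    (forall p q, P p -> P q -> P (p + q)) -> (forall p, P p -> P (- p)) ->
    (forall k p, P p -> P (k *: p)) ->
    (forall p q, P p -> P q -> P [lie p, q]) ->
  forall p, P p.
Proof.
move=> Pg P0 PD PN PZ PB; elim/allE; elim=> [x||a Pa b Pb|a Pa|k a Pa|a Pa b Pb].
- exact: Pg.
- by rewrite lie_class0.
- by rewrite lie_classD; apply: PD.
- by rewrite lie_classN; apply: PN.
- by rewrite lie_classZ; apply: PZ.
- by rewrite lie_class_bracket; apply: PB.
Qed.

Section Lift.
Context {L : lieAlgType K}.
Variable f : X -> L.

Fixpoint lie_eval (a : lie_term K X) : L :=
  match a with
  | LGen x => f x
  | LZero => 0
  | LAdd a b => lie_eval a + lie_eval b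
  | LOpp a => - lie_eval a
  | LScale k a => k *: lie_eval a
  | LBracket a b => [lie lie_eval a, lie_eval b]
  end.

(* The morphism induced by f, provided that f respects R. *)
Definition lie_lift (p : presented) : L := lie_eval (repr p).

Hypothesis fR : forall a b, R a b -> lie_eval a = lie_eval b.

Lemma lie_eval_eq a b : lie_eq a b -> lie_eval a = lie_eval b.
Proof.
elim=> //= {a b}; try by [move=> *; congruence].
- by move=> *; rewrite addrA.
- by move=> *; rewrite addrC.
- by move=> *; rewrite add0r.
- by move=> *; rewrite addNr.
- by move=> *; rewrite scalerA.
- by move=> *; rewrite scale1r.
- by move=> *; rewrite scalerDr.
- by move=> *; rewrite scalerDl.
- by move=> *; rewrite bracketDl bracketZl.
- by move=> *; rewrite bracketDr bracketZr.
- by move=> *; rewrite bracketxx.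
- by move=> *; rewrite bracket_jacobi.
Qed.

Lemma lie_liftE a : lie_lift (lie_class a) = lie_eval a.
Proof. exact/lie_eval_eq/lie_eq_repr. Qed.

Lemma lie_lift_linear : linear lie_lift.
Proof.
move=> k; elim/allE=> a; elim/allE=> b.
by rewrite -lie_classZ -lie_classD !lie_liftE.
Qed.

Lemma lie_lift_bracket p q : lie_lift [lie p, q] = [lie lie_lift p, lie_lift q].
Proof.
elim/allE: p => a; elim/allE: q => b.
by rewrite -lie_class_bracket !lie_liftE.
Qed.

End Lift.

Section Derivation.
Variable d : X -> presented.

Fixpoint lie_der_term (a : lie_term K X) : presented :=
  match a with
  | LGen x => d x
  | LZero => 0
  | LAdd a b => lie_der_term a + lie_der_term b
  | LOpp a => - lie_der_term a
  | LScale k a => k *: lie_der_term a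
  | LBracket a b =>
      [lie lie_der_term a, lie_class b] + [lie lie_class a, lie_der_term b]
  end.

(* The derivation with values d on generators, provided that d respects R. *)
Definition lie_der (p : presented) : presented := lie_der_term (repr p).

Hypothesis dR : forall a b, R a b -> lie_der_term a = lie_der_term b.

Lemma lie_der_term_eq a b : lie_eq a b -> lie_der_term a = lie_der_term b.
Proof.
elim=> //= {a b}; try by [move=> *; congruence].
- by move=> a a' b b' /lie_classP -> -> /lie_classP -> ->.
- by move=> *; rewrite addrA.
- by move=> *; rewrite addrC.
- by move=> *; rewrite add0r.
- by move=> *; rewrite addNr.
- by move=> *; rewrite scalerA.
- by move=> *; rewrite scale1r.
- by move=> *; rewrite scalerDr.
- by move=> *; rewrite scalerDl.
- move=> k a b c.
  by rewrite lie_classD lie_classZ !bracketDl !bracketZl scalerDr addrACA.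
- move=> k a b c.
  by rewrite lie_classD lie_classZ !bracketDr !bracketZr scalerDr addrACA.
- by move=> a; rewrite (bracketC (lie_class a)) addrN.
- move=> a b c; rewrite !lie_class_bracket !bracketDr.
  set a' := lie_der_term a; set b' := lie_der_term b; set c' := lie_der_term c.
  set x := lie_class a; set y := lie_class b; set z := lie_class c.
  rewrite !addrA (AC 9 ((1*6*8)*(2*4*9)*(3*5*7)))%AC /=.
  by rewrite !bracket_jacobi !addr0.
Qed.

Lemma lie_derE a : lie_der (lie_class a) = lie_der_term a.
Proof. exact/lie_der_term_eq/lie_eq_repr. Qed.

Lemma lie_der_linear : linear lie_der.
Proof.
move=> k; elim/allE=> a; elim/allE=> b.
by rewrite -lie_classZ -lie_classD !lie_derE.
Qed.

Lemma lie_der_bracket p q :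
  lie_der [lie p, q] = [lie lie_der p, q] + [lie p, lie_der q].
Proof.
elim/allE: p => a; elim/allE: q => b.
by rewrite -lie_class_bracket !lie_derE.
Qed.

End Derivation.

End Presentation.

Record is_lie_action (K : fieldType) (M N : lieAlgType K)
    (act : M -> N -> N) : Prop := IsLieAction {
  act_linearl : forall n, linear (fun m => act m n);
  act_linearr : forall m, linear (act m);
  act_bracketl : forall m m' n,
    act [lie m, m'] n = act m (act m' n) - act m' (act m n);
  act_bracketr : forall m n n',
    act m [lie n, n'] = [lie act m n, n'] + [lie n, act m n']
}.

Definition compatible_actions (K : fieldType) (M N : lieAlgType K)
    (actMN : M -> N -> N) (actNM : N -> M -> M) : Prop :=
  (forall m m' n, actNM (actMN m n) m' = [lie m', actNM n m]) /\
  (forall m n n', actMN (actNM n m) n' = [lie n', actMN m n]).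

Section ZmoduleIdentities.
Context {V : zmodType}.
Implicit Types A B C D E F : V.

Lemma zmod_aux1 A B C D E F :
  A - B + (C - (D - B)) + (E - A - F) = E + C - (D + F).
Proof.
rewrite !opprD !opprK !addrA.
rewrite (AC 8 ((6*3)*4*8*(1*7)*(2*5)))%AC /= addrN addNr !addr0.
by [].
Qed.

Lemma zmod_aux2 A B E G X Y :
  A - X + (Y - B) + (- Y + E - (- X + G)) = A + E - (B + G).
Proof.
rewrite !opprD !opprK !addrA.
rewrite (AC 8 ((1*6)*4*8*(2*7)*(3*5)))%AC /= addrN addNr !addr0.
by [].
Qed.

Lemma zmod_aux3 A B C D :
  - A - (B - A) + (C - (C + D)) = - (B + D).
Proof.
rewrite !opprD !opprK !addrA.
rewrite (AC 6 (2*6*(1*3)*(4*5)))%AC /= addrN addNr !addr0.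
by [].
Qed.

Lemma zmod_aux4 A B C D E F :
  A - B + (C - D) = A + E + (F + C) - (B + F + (E + D)).
Proof.
rewrite !opprD !addrA.
rewrite [RHS](AC 8 (1*5*4*8*(2*7)*(3*6)))%AC /= !addrN !addr0.
by [].
Qed.

End ZmoduleIdentities.

Section Bilinear.
Context {K : fieldType} {U V W : lmodType K}.
Variable f : U -> V -> W.
Hypothesis fl : forall v, linear (fun u => f u v).
Hypothesis fr : forall u, linear (f u).

Lemma bilinDl u u' v : f (u + u') v = f u v + f u' v.
Proof. by have := fl v 1 u u'; rewrite !scale1r. Qed.
Lemma bilinDr u v v' : f u (v + v') = f u v + f u v'.
Proof. by have := fr u 1 v v'; rewrite !scale1r. Qed.
Lemma bilin0l v : f 0 v = 0.
Proof. by apply: (addIr (f 0 v)); rewrite -bilinDl !add0r. Qed.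
Lemma bilin0r u : f u 0 = 0.
Proof. by apply: (addIr (f u 0)); rewrite -bilinDr !add0r. Qed.
Lemma bilinZl k u v : f (k *: u) v = k *: f u v.
Proof. by have := fl v k u 0; rewrite !addr0 bilin0l addr0. Qed.
Lemma bilinZr k u v : f u (k *: v) = k *: f u v.
Proof. by have := fr u k v 0; rewrite !addr0 bilin0r addr0. Qed.
Lemma bilinNl u v : f (- u) v = - f u v.
Proof. by rewrite -scaleN1r bilinZl scaleN1r. Qed.
Lemma bilinNr u v : f u (- v) = - f u v.
Proof. by rewrite -scaleN1r bilinZr scaleN1r. Qed.
End Bilinear.

Section Tensor.
Context {K : fieldType} {M N : lieAlgType K}.
Variables (actMN : M -> N -> N) (actNM : N -> M -> M).
Implicit Types (m : M) (n : N) (k : K).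

Let tgen m n : lie_term K (M * N) := LGen (m, n).
Local Notation "m '(x)' n" := (tgen m%R n%R) (at level 35) : lie_term_scope.
Local Open Scope lie_term_scope.

Inductive tensor_rel : lie_term K (M * N) -> lie_term K (M * N) -> Prop :=
| tensor_relZl k m n : tensor_rel (k *: (m (x) n)) ((k *: m) (x) n)
| tensor_relZr k m n : tensor_rel (k *: (m (x) n)) (m (x) (k *: n))
| tensor_relDl m m' n : tensor_rel ((m + m') (x) n) (m (x) n + m' (x) n)
| tensor_relDr m n n' : tensor_rel (m (x) (n + n')) (m (x) n + m (x) n')
| tensor_relBr m n n' :
    tensor_rel (m (x) [lie n, n']) (actNM n' m (x) n - actNM n m (x) n')
| tensor_relBl m m' n :
    tensor_rel ([lie m, m'] (x) n) (m (x) actMN m' n - m' (x) actMN m n)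
| tensor_relB m n m' n' :
    tensor_rel [lie m (x) n, m' (x) n'] (- (actNM n m (x) actMN m' n')).

Local Close Scope lie_term_scope.

Definition tensor : lieAlgType K := presented tensor_rel.

Definition tens m n : tensor := lie_class tensor_rel (LGen (m, n)).

(* The morphism from the tensor product to N sending m (x) n to actMN m n; it
   is well defined when the actions are compatible Lie actions (tensor_nuE). *)
Definition tensor_nu : tensor -> N := lie_lift (fun mn => actMN mn.1 mn.2).

(* Determined by its values on generators because it acts by derivations; like
   tensor_nu it is well defined for compatible Lie actions (tensor_actE). *)
Definition tensor_act n : tensor -> tensor :=
  lie_der (fun mn => tens (actNM n mn.1) mn.2 + tens mn.1 [lie n, mn.2]).

Definition tensor_coact (w : tensor) n : N := [lie tensor_nu w, n].

Let relE a b : tensor_rel a b -> lie_class tensor_rel a = lie_class tensor_rel b.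
Proof. by move=> ab; apply/lie_classP/lie_eq_rel. Qed.

Lemma tensZl k m n : tens (k *: m) n = k *: tens m n.
Proof. by rewrite -lie_classZ; apply/esym/relE/tensor_relZl. Qed.
Lemma tensZr k m n : tens m (k *: n) = k *: tens m n.
Proof. by rewrite -lie_classZ; apply/esym/relE/tensor_relZr. Qed.
Lemma tensDl m m' n : tens (m + m') n = tens m n + tens m' n.
Proof. by rewrite -lie_classD; apply/relE/tensor_relDl. Qed.
Lemma tensDr m n n' : tens m (n + n') = tens m n + tens m n'.
Proof. by rewrite -lie_classD; apply/relE/tensor_relDr. Qed.
Lemma tens_bracketr m n n' :
  tens m [lie n, n'] = tens (actNM n' m) n - tens (actNM n m) n'.
Proof. by rewrite -lie_classN -lie_classD; apply/relE/tensor_relBr. Qed.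
Lemma tens_bracketl m m' n :
  tens [lie m, m'] n = tens m (actMN m' n) - tens m' (actMN m n).
Proof. by rewrite -lie_classN -lie_classD; apply/relE/tensor_relBl. Qed.
Lemma bracket_tens m n m' n' :
  [lie tens m n, tens m' n'] = - tens (actNM n m) (actMN m' n').
Proof. by rewrite -lie_class_bracket -lie_classN; apply/relE/tensor_relB. Qed.
Lemma tensNl m n : tens (- m) n = - tens m n.
Proof. by rewrite -scaleN1r tensZl scaleN1r. Qed.
Lemma tensNr m n : tens m (- n) = - tens m n.
Proof. by rewrite -scaleN1r tensZr scaleN1r. Qed.

Lemma tensor_ind (P : tensor -> Prop) :
    (forall m n, P (tens m n)) -> P 0 ->
    (forall p q, P p -> P q -> P (p + q)) -> (forall p, P p -> P (- p)) ->
    (forall k p, P p -> P (k *: p)) ->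
    (forall p q, P p -> P q -> P [lie p, q]) ->
  forall p, P p.
Proof.
move=> Pg P0 PD PN PZ PB; elim/(@presented_ind _ _ tensor_rel) => //.
by case=> m n; exact: Pg.
Qed.

Hypothesis actMN_lie : is_lie_action actMN.
Hypothesis actNM_lie : is_lie_action actNM.
Hypothesis compat : compatible_actions actMN actNM.

Let MNl := act_linearl actMN_lie.
Let MNr := act_linearr actMN_lie.
Let NMl := act_linearl actNM_lie.
Let NMr := act_linearr actNM_lie.
Let compatM := compat.1.
Let compatN := compat.2.

Fact tensor_nu_rel a b : tensor_rel a b ->
  lie_eval (fun mn => actMN mn.1 mn.2) a = lie_eval (fun mn => actMN mn.1 mn.2) b.
Proof.
case=> /= {a b}.
- by move=> k m n; rewrite (bilinZl MNl).
- by move=> k m n; rewrite (bilinZr MNr).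
- by move=> m m' n; rewrite (bilinDl MNl).
- by move=> m n n'; rewrite (bilinDr MNr).
- move=> m n n'; rewrite (act_bracketr actMN_lie) !compatN addrC.
  by congr (_ + _); apply: bracketC.
- by move=> m m' n; rewrite (act_bracketl actMN_lie).
- by move=> m n m' n'; rewrite compatN bracketC.
Qed.

Lemma tensor_nuE m n : tensor_nu (tens m n) = actMN m n.
Proof. exact: (lie_liftE tensor_nu_rel). Qed.

Lemma tensor_nu_linear : linear tensor_nu.
Proof. exact: (lie_lift_linear tensor_nu_rel). Qed.

Lemma tensor_nu_bracket w w' :
  tensor_nu [lie w, w'] = [lie tensor_nu w, tensor_nu w'].
Proof. exact: (lie_lift_bracket tensor_nu_rel). Qed.

Let d n (mn : M * N) : tensor :=
  tens (actNM n mn.1) mn.2 + tens mn.1 [lie n, mn.2].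

Fact tensor_act_rel n a b :
  tensor_rel a b -> lie_der_term (d n) a = lie_der_term (d n) b.
Proof.
rewrite /d; case=> /= {a b}.
- move=> k m n'.
  by rewrite (bilinZr NMr) !tensZl scalerDr.
- move=> k m n'.
  by rewrite bracketZr !tensZr scalerDr.
- by move=> m m' n'; rewrite (bilinDr NMr) !tensDl addrACA.
- by move=> m p n'; rewrite bracketDr !tensDr addrACA.
- move=> m p q; rewrite bracketA tensDr (tens_bracketr _ p q).
  rewrite (tens_bracketr m [lie n, p]) (tens_bracketr m p).
  rewrite !(act_bracketl actNM_lie) !tensDl !tensNl.
  by rewrite addrA zmod_aux1.
- move=> m m' p.
  rewrite (act_bracketr actNM_lie) tensDl !(tens_bracketl _ _ p).
  rewrite (tens_bracketl _ _ [lie n, p]) !(act_bracketr actMN_lie).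
  rewrite !tensDr !compatN (bracketC (actMN m' n) p) (bracketC (actMN m n) p).
  rewrite !tensNr; exact: zmod_aux2.
- move=> m p m' p'.
  rewrite bracketDl bracketDr !bracket_tens (act_bracketl actNM_lie) compatN.
  rewrite (act_bracketr actMN_lie) tensDl tensDr tensNl (bracketC p') tensNr.
  rewrite opprK; exact: zmod_aux3.
Qed.

Lemma tensor_actE n m n' :
  tensor_act n (tens m n') = tens (actNM n m) n' + tens m [lie n, n'].
Proof. exact: (lie_derE (@tensor_act_rel n)). Qed.

Lemma tensor_act_linear n : linear (tensor_act n).
Proof. exact: (lie_der_linear (@tensor_act_rel n)). Qed.

Lemma tensor_act_bracket n w w' :
  tensor_act n [lie w, w'] = [lie tensor_act n w, w'] + [lie w, tensor_act n w'].
Proof. exact: (lie_der_bracket (@tensor_act_rel n)). Qed.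

Let AD n w w' : tensor_act n (w + w') = tensor_act n w + tensor_act n w'.
Proof. by have := tensor_act_linear n 1 w w'; rewrite !scale1r. Qed.
Let A0 n : tensor_act n 0 = 0.
Proof. by apply: (addIr (tensor_act n 0)); rewrite -AD !add0r. Qed.
Let AZ n k w : tensor_act n (k *: w) = k *: tensor_act n w.
Proof. by have := tensor_act_linear n k w 0; rewrite !addr0 A0 addr0. Qed.
Let AN n w : tensor_act n (- w) = - tensor_act n w.
Proof. by rewrite -scaleN1r AZ scaleN1r. Qed.
Let nuD w w' : tensor_nu (w + w') = tensor_nu w + tensor_nu w'.
Proof. by have := tensor_nu_linear 1 w w'; rewrite !scale1r. Qed.
Let nu0 : tensor_nu 0 = 0.
Proof. by apply: (addIr (tensor_nu 0)); rewrite -nuD !add0r. Qed.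
Let nuZ k w : tensor_nu (k *: w) = k *: tensor_nu w.
Proof. by have := tensor_nu_linear k w 0; rewrite !addr0 nu0 addr0. Qed.
Let nuN w : tensor_nu (- w) = - tensor_nu w.
Proof. by rewrite -scaleN1r nuZ scaleN1r. Qed.

Lemma tensor_act_linearl w : linear (fun n => tensor_act n w).
Proof.
move=> k n n'; elim/tensor_ind: w => [m p||w w'|w|l w|w w'].
- rewrite !tensor_actE (bilinDl NMl) (bilinZl NMl) bracketDl bracketZl.
  by rewrite tensDl tensDr tensZl tensZr scalerDr addrACA.
- by rewrite !A0 scaler0 addr0.
- by move=> E E'; rewrite !AD E E' scalerDr addrACA.
- by move=> E; rewrite !AN E opprD scalerN.
- by move=> E; rewrite !AZ E scalerDr !scalerA mulrC.
- move=> E E'; rewrite !tensor_act_bracket E E' bracketDl bracketDr.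
  by rewrite bracketZl bracketZr scalerDr addrACA.
Qed.

Lemma tensor_act_bracketl n n' w :
  tensor_act [lie n, n'] w
  = tensor_act n (tensor_act n' w) - tensor_act n' (tensor_act n w).
Proof.
elim/tensor_ind: w => [m p||w w'|w|l w|w w'].
- rewrite !tensor_actE !AD !tensor_actE (act_bracketl actNM_lie) tensDl tensNl.
  rewrite (_ : [lie [lie n, n'], p] = [lie n, [lie n', p]] - [lie n', [lie n, p]]).
    rewrite tensDr tensNr; exact: zmod_aux4.
  by rewrite bracketA addrK.
- by rewrite !A0 subrr.
- by move=> E E'; rewrite !AD E E' opprD addrACA.
- by move=> E; rewrite !AN E opprD.
- by move=> E; rewrite !AZ E scalerBr.
- move=> E E'; rewrite !tensor_act_bracket !AD !tensor_act_bracket E E'.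
  rewrite bracketDl bracketNl bracketDr bracketNr; exact: zmod_aux4.
Qed.

Lemma tensor_act_lie : is_lie_action tensor_act.
Proof.
split.
- exact: tensor_act_linearl.
- exact: tensor_act_linear.
- exact: tensor_act_bracketl.
- exact: tensor_act_bracket.
Qed.

Lemma tensor_coact_lie : is_lie_action tensor_coact.
Proof.
split; rewrite /tensor_coact.
- by move=> n k w w'; rewrite nuD nuZ bracketDl bracketZl.
- by move=> w k n n'; rewrite bracketDr bracketZr.
- by move=> w w' n; rewrite tensor_nu_bracket (bracketA (tensor_nu w)) addrK.
- by move=> w n n'; rewrite bracketA.
Qed.

Lemma tensor_nu_act n w : tensor_nu (tensor_act n w) = [lie n, tensor_nu w].
Proof.
elim/tensor_ind: w => [m p||w w'|w|l w|w w'].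
- rewrite tensor_actE nuD !tensor_nuE compatN (act_bracketr actMN_lie).
  by rewrite (bracketC p) addKr.
- by rewrite A0 nu0 bracket0r.
- by move=> E E'; rewrite AD !nuD E E' bracketDr.
- by move=> E; rewrite AN !nuN E bracketNr.
- by move=> E; rewrite AZ !nuZ E bracketZr.
- move=> E E'; rewrite tensor_act_bracket nuD !tensor_nu_bracket E E'.
  by rewrite -bracketA.
Qed.

Lemma tensor_act_nu w w' : tensor_act (tensor_nu w) w' = [lie w, w'].
Proof.
have TDl := bilinDl tensor_act_linearl; have TZl := bilinZl tensor_act_linearl.
elim/tensor_ind: w w' => [m n||u v|u|l u|u v].
- elim/tensor_ind=> [m' n'||w w'|w|l w|w w'].
  + rewrite tensor_nuE tensor_actE compatM bracket_tens.
    rewrite tens_bracketl compatN (bracketC n') tensNr.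
    by rewrite addrAC addNr add0r.
  + by rewrite A0 bracket0r.
  + by move=> E E'; rewrite AD E E' bracketDr.
  + by move=> E; rewrite AN E bracketNr.
  + by move=> E; rewrite AZ E bracketZr.
  + by move=> E E'; rewrite tensor_act_bracket E E' -bracketA.
- by move=> w'; rewrite nu0 (bilin0l tensor_act_linearl) bracket0l.
- by move=> E E' w'; rewrite nuD TDl E E' bracketDl.
- by move=> E w'; rewrite nuN (bilinNl tensor_act_linearl) E bracketNl.
- by move=> E w'; rewrite nuZ TZl E bracketZl.
- move=> E E' w'; rewrite tensor_nu_bracket tensor_act_bracketl !E !E'.
  by rewrite (bracketA u) addrK.
Qed.

Lemma tensor_compatible : compatible_actions tensor_coact tensor_act.
Proof.
split=> [w w' n|w n n']; rewrite /tensor_coact.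
- rewrite tensor_act_bracketl !tensor_act_nu tensor_act_bracket.
  by rewrite opprD addrCA subrr addr0 -bracketC.
- by rewrite tensor_nu_act (bracketC n') -bracketNl -bracketC.
Qed.

End Tensor.

(* A Lie algebra P together with compatible mutual actions of P and N: the data
   needed to form P (x) N and to iterate the construction. *)
Record lie_pair (K : fieldType) (N : lieAlgType K) := LiePair {
  pair_alg :> lieAlgType K;
  pair_act : pair_alg -> N -> N;
  pair_coact : N -> pair_alg -> pair_alg;
  pair_act_lie : is_lie_action pair_act;
  pair_coact_lie : is_lie_action pair_coact;
  pair_compatible : compatible_actions pair_act pair_coact
}.

Section TensorPower.
Context {K : fieldType}.
Variable m : lieAlgType K.

Lemma adjoint_lie : is_lie_action (@bracket K m).
Proof.
split.
- exact: bracket_linearl.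
- exact: bracket_linearr.
- by move=> x y z; rewrite (bracketA x) addrK.
- exact: bracketA.
Qed.

Lemma adjoint_compatible : compatible_actions (@bracket K m) (@bracket K m).
Proof.
split=> [x y z|x y z]; rewrite bracketC.
- by rewrite (bracketC x z) bracketNr opprK.
- by rewrite (bracketC y x) bracketNr opprK.
Qed.

Definition adjoint_pair : lie_pair m :=
  LiePair adjoint_lie adjoint_lie adjoint_compatible.

Definition tensor_pair (P : lie_pair m) : lie_pair m :=
  LiePair
    (tensor_coact_lie (pair_act_lie P) (pair_compatible P))
    (tensor_act_lie (pair_act_lie P) (pair_coact_lie P) (pair_compatible P))
    (tensor_compatible (pair_act_lie P) (pair_coact_lie P) (pair_compatible P)).

(* Indices start at 1: tensor_power 1 is m, with the adjoint actions, and
   tensor_power i.+1 is (tensor_power i) (x) m for i >= 1; tensor_power 0 is a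
   junk value. *)
Fixpoint tensor_power (i : nat) : lie_pair m :=
  if i is (j.+1 as i').+1 then tensor_pair (tensor_power i') else adjoint_pair.

End TensorPower.

Fact tensor_power1 (K : fieldType) (m : lieAlgType K) :
  tensor_power m 1 = m :> lieAlgType K.
Proof. by []. Qed.

Fact tensor_powerS (K : fieldType) (m : lieAlgType K) (i : nat) :
  tensor_power m i.+2
  = tensor (@pair_act _ _ (tensor_power m i.+1))
           (@pair_coact _ _ (tensor_power m i.+1)) :> lieAlgType K.
Proof. by []. Qed.

Fact gamma1 (K : fieldType) (L : lieAlgType K) : gamma_ L 1 = setT.
Proof. by []. Qed.

Fact gammaS (K : fieldType) (L : lieAlgType K) (i : nat) :
  gamma_ L i.+2 = commutator (gamma_ L i.+1) setT.
Proof. by []. Qed.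

(* Main.v *)
Require Import Defs.
From mathcomp Require Import all_boot all_order all_algebra.
From mathcomp Require Import boolp classical_sets.

(** Write T_i for the i-th tensor power of m. The actions between T_i and m are
    those of a crossed module lambda : T_i -> m: an element w of T_i acts on m
    as the bracket with lambda(w), and lambda(w) acts on T_i as the bracket
    with w (the Peiffer identity). For i = 1 the map lambda is the identity,
    and afterwards it is nu; by induction its image is gamma_i(m)
    ([tensor_power_crossed_module]). So gamma_i(m) is a quotient of T_i, which
    gives the implication from (ii) to (i).

    For the converse, suppose that gamma_{i+1}(m) is finitely generated. Since
    m is finitely generated, gamma_i(m) / gamma_{i+1}(m) is finite-dimensional
    ([gamma_quotient_fg]), so gamma_i(m) is finitely generated as well
    ([gamma_fg_pred]), and by induction on i so is T_i. The step from T_i to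
    T = T_i (x) m is [tensor_fg]. Let W, Y and G be finite sets generating T_i,
    m and gamma_{i+1}(m), and let S be the subalgebra of T generated by W (x) Y,
    W (x) G and one lift of each element of G. It exhausts T:
    - S maps onto gamma_{i+1}(m) and, by the Peiffer identity, the kernel of nu
      is central; so a bracket in T does not change when its arguments are
      replaced by elements of S with the same images, and S contains [T, T]
      ([derived_sub_of_onto]).
    - The relation for [w (x) n, w' (x) n'] shows that ^n w (x) g is in [T, T]
      for every g in gamma_{i+1}(m) ([coact_tens_range_derived]). Brackets in
      T_i have the form ^n w, and this lets the expansions of w (x) [g, g'] and
      of [w, w'] (x) g be absorbed in S; from W (x) G one reaches
      T_i (x) gamma_{i+1}(m) ([tens_range_sub]).
    - In [w, w'] (x) y = w (x) ^{w'}y - w' (x) ^w y the right-hand factors are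
      in gamma_{i+1}(m), so that W (x) Y gives T_i (x) Y, and then the expansion
      of w (x) [n, n'] gives T_i (x) m ([tensor_sub]). *)

Set Implicit Arguments.
Unset Strict Implicit.
Unset Printing Implicit Defensive.

Import GRing.Theory.

Local Open Scope classical_set_scope.
Local Open Scope ring_scope.

(** * Subspaces, subalgebras and finite generation *)

Section Subalgebras.
Context {K : fieldType} {L : lieAlgType K}.
Implicit Types (A : set L) (s : seq L).

Lemma smallest_submodule A : is_submodule (smallest is_submodule A).
Proof.
split=> [B [[]] //|x y Bx By B BA|k x Bx B BA].
- by have [[_ BD _] _] := BA; apply: BD; [exact: Bx | exact: By].
- by have [[_ _ BZ] _] := BA; apply: BZ; exact: Bx.
Qed.

Lemma smallest_lie_subalgebra A :
  is_lie_subalgebra (smallest is_lie_subalgebra A).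
Proof.
split; first split=> [B [[[]]] //|x y Bx By B BA|k x Bx B BA].
- by have [[[_ BD _] _] _] := BA; apply: BD; [exact: Bx | exact: By].
- by have [[[_ _ BZ] _] _] := BA; apply: BZ; exact: Bx.
- move=> x y Bx By B BA.
  by have [[_ Bb] _] := BA; apply: Bb; [exact: Bx | exact: By].
Qed.

Lemma full_lie_subalgebra : is_lie_subalgebra [set: L].
Proof. by []. Qed.

Lemma submoduleN A x : is_submodule A -> A x -> A (- x).
Proof. by case=> _ _ AZ Ax; rewrite -scaleN1r; apply: AZ. Qed.

Lemma submoduleB A x y : is_submodule A -> A x -> A y -> A (x - y).
Proof.
by move=> sA Ax Ay; case: (sA) => _ AD _; apply: AD => //; apply: submoduleN.
Qed.

Lemma fg_intro A s : is_lie_subalgebra A -> [set` s] `<=` A ->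
  A `<=` smallest is_lie_subalgebra [set` s] -> finitely_generated A.
Proof.
by move=> lA sA As; exists s; apply/seteqP; split=> //; apply: smallest_sub.
Qed.

End Subalgebras.

(** * Morphisms of Lie algebras *)

Section Morphisms.
Context {K : fieldType} {L L' : lieAlgType K}.
Variable f : L -> L'.
Hypothesis f_linear : linear f.

Lemma linear_D x y : f (x + y) = f x + f y.
Proof. by have := f_linear 1 x y; rewrite !scale1r. Qed.

Lemma linear_0 : f 0 = 0.
Proof. by apply: (addIr (f 0)); rewrite -linear_D !add0r. Qed.

Lemma linear_Z k x : f (k *: x) = k *: f x.
Proof. by have := f_linear k x 0; rewrite linear_0 !addr0. Qed.

Hypothesis f_bracket : {morph f : x y / [lie x, y]}.

Lemma image_lie_subalgebra A :
  is_lie_subalgebra A -> is_lie_subalgebra (f @` A).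
Proof.
move=> [[A0 AD AZ] Ab]; split; first split.
- by exists 0; rewrite ?linear_0.
- move=> _ _ [x Ax <-] [y Ay <-].
  by exists (x + y); rewrite ?linear_D //; apply: AD.
- by move=> k _ [x Ax <-]; exists (k *: x); rewrite ?linear_Z //; apply: AZ.
- move=> _ _ [x Ax <-] [y Ay <-].
  by exists [lie x, y]; rewrite ?f_bracket //; apply: Ab.
Qed.

Lemma preimage_lie_subalgebra B :
  is_lie_subalgebra B -> is_lie_subalgebra (f @^-1` B).
Proof.
move=> [[B0 BD BZ] Bb]; split; first split=> /=.
- by rewrite linear_0.
- by move=> x y Bx By; rewrite linear_D; apply: BD.
- by move=> k x Bx; rewrite linear_Z; apply: BZ.
- by move=> x y Bx By; rewrite /= f_bracket; apply: Bb.
Qed.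

Lemma fg_range :
  finitely_generated [set: L] -> finitely_generated (range f).
Proof.
move=> [s sT]; apply: (@fg_intro _ _ _ (map f s)).
- exact/image_lie_subalgebra/full_lie_subalgebra.
- by move=> _ /mapP[x _ ->]; exists x.
- move=> _ [x _ <-]; move: x (I : [set: L] x).
  rewrite sT; apply: smallest_sub.
    exact/preimage_lie_subalgebra/smallest_lie_subalgebra.
  by move=> x xs; apply: sub_gen_smallest; apply/mapP; exists x.
Qed.

End Morphisms.

(** * The lower central series *)

Section LowerCentralSeries.
Context {K : fieldType} {L : lieAlgType K}.
Implicit Types (x y z : L).

Lemma gamma_submodule i : is_submodule (gamma_ L i.+1).
Proof. by case: i => [|i] /=; [| exact: smallest_submodule]. Qed.

Lemma gamma_bracket i x y : gamma_ L i.+1 x -> gamma_ L i.+2 [lie x, y].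
Proof. by move=> xi; apply: sub_gen_smallest; exists x => //; exists y. Qed.

Lemma gammaS_sub i (B : set L) : is_submodule B ->
    (forall x y, gamma_ L i.+1 x -> B [lie x, y]) -> gamma_ L i.+2 `<=` B.
Proof.
by move=> sB Bxy; apply: smallest_sub => // _ [x xi [y _ <-]]; apply: Bxy.
Qed.

Lemma gamma_decreasing i : gamma_ L i.+2 `<=` gamma_ L i.+1.
Proof.
elim: i => [//|i IH]; apply: gammaS_sub; first exact: gamma_submodule.
by move=> x y /IH; apply: gamma_bracket.
Qed.

Lemma gamma_lie_subalgebra i : is_lie_subalgebra (gamma_ L i.+1).
Proof.
split; first exact: gamma_submodule.
by move=> x y xi _; apply: gamma_decreasing; apply: gamma_bracket.
Qed.

(** [gamma_i, gamma_2] lies in gamma_{i+2}: by the Jacobi identity the double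
    bracket is a combination of [[x, y], z] and [[x, z], y]. *)
Lemma gamma_bracket_bracket i x y z :
  gamma_ L i.+1 x -> gamma_ L i.+3 [lie x, [lie y, z]].
Proof.
move=> xi; rewrite bracketA (bracketC y).
by apply: (submoduleB (gamma_submodule _)); do 2! apply: gamma_bracket.
Qed.

(** Each quotient of consecutive terms is finite-dimensional: the bracket
    induces a bilinear map from gamma_i / gamma_{i+1} and L / gamma_2 to
    gamma_{i+1} / gamma_{i+2} whose values span, so the brackets of finitely
    many spanning elements with the generators of L span the next quotient. *)
Lemma gamma_quotient_fg i : finitely_generated [set: L] ->
  exists2 s : seq L, [set` s] `<=` gamma_ L i.+1 &
    gamma_ L i.+1 `<=` smallest is_submodule ([set` s] `|` gamma_ L i.+2).
Proof.
move=> [Y YT]; elim: i => [|i [s si IH]].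
  exists Y => //; rewrite {1}gamma1 YT.
  apply: smallest_sub; last by move=> y yY; apply: sub_gen_smallest; left.
  split; first exact: smallest_submodule.
  by move=> x y _ _; apply: sub_gen_smallest; right; apply: gamma_bracket.
exists [seq [lie x, y] | x <- s, y <- Y].
  by move=> _ /allpairsP[[x y] [/= xs _ ->]]; apply: gamma_bracket; apply: si.
set B := smallest _ _; have subB : is_submodule B by apply: smallest_submodule.
have [B0 BD BZ] := subB.
have inB x : gamma_ L i.+3 x -> B x.
  by move=> xi; apply: sub_gen_smallest; right.
apply: gammaS_sub => // x y xi; move: x {xi}(IH _ xi) y.
apply: smallest_sub.
  split=> [y|x x' Bx Bx' y|k x Bx y].
  - by rewrite bracket0l.
  - by rewrite bracketDl; apply: BD.
  - by rewrite bracketZl; apply: BZ.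
move=> x [xs|xi] y; last by apply: inB; apply: gamma_bracket.
(* The elements y with [x, y] in B form a subalgebra: for a bracket of two of
   them [gamma_bracket_bracket] applies. *)
move: y (I : [set: L] y); rewrite YT; apply: smallest_sub.
  split; first split=> /=.
  - by rewrite bracket0r.
  - by move=> y y' By By'; rewrite bracketDr; apply: BD.
  - by move=> k y By; rewrite bracketZr; apply: BZ.
  - by move=> y y' _ _; apply: inB; apply: gamma_bracket_bracket; apply: si.
move=> y yY; apply: sub_gen_smallest; left => /=.
by apply/allpairsP; exists (x, y).
Qed.

(** Generators of gamma_{i+2} together with elements of gamma_{i+1} spanning the
    finite-dimensional quotient generate gamma_{i+1}. *)
Lemma gamma_fg_pred i : finitely_generated [set: L] ->
  finitely_generated (gamma_ L i.+2) -> finitely_generated (gamma_ L i.+1).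
Proof.
move=> Lfg [G GE]; have [s si ssp] := gamma_quotient_fg i Lfg.
have Gi : [set` G] `<=` gamma_ L i.+2 by rewrite GE; apply: sub_gen_smallest.
apply: (@fg_intro _ _ _ (s ++ G)); first exact: gamma_lie_subalgebra.
  move=> x /=; rewrite mem_cat => /orP[/si //|xG].
  by apply: gamma_decreasing; apply: Gi.
apply: (subset_trans ssp); apply: smallest_sub.
  by case: (smallest_lie_subalgebra [set` s ++ G]).
have GsG : [set` G] `<=` [set` s ++ G].
  by move=> y /= yG; rewrite mem_cat yG orbT.
move=> x [xs|]; first by apply: sub_gen_smallest; rewrite /= mem_cat xs.
rewrite GE; move: x; apply: smallest_sub; first exact: smallest_lie_subalgebra.
by move=> x /GsG; apply: sub_gen_smallest.
Qed.

End LowerCentralSeries.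

(** * Crossed modules and their tensor products *)

Section CrossedModule.
Context {K : fieldType} {N : lieAlgType K}.

Record is_crossed_module (P : lie_pair N) (lam : P -> N) : Prop :=
    IsCrossedModule {
  crossed_linear : linear lam;
  crossed_bracket : {morph lam : w w' / [lie w, w']};
  crossed_act : forall w n, pair_act w n = [lie lam w, n];
  crossed_peiffer : forall w w', pair_coact (lam w) w' = [lie w, w']
}.

Lemma adjoint_crossed_module : is_crossed_module (P := adjoint_pair N) id.
Proof. by split. Qed.

(** A symbol w (x) n typed in the carrier of [tensor_pair P], so that its Lie
    algebra structure and actions are found by unification; the tensor relations
    are restated for it. *)
Definition pair_tens (P : lie_pair N) (w : P) (n : N) : tensor_pair P :=
  tens (@pair_act _ _ P) (@pair_coact _ _ P) w n.

Lemma pair_tens_generate (P : lie_pair N) (A : set (tensor_pair P)) :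
  is_lie_subalgebra A -> (forall w n, A (pair_tens w n)) -> forall t, A t.
Proof.
move=> [AM Ab] At; have [A0 AD AZ] := AM.
elim/(@tensor_ind _ _ _ (@pair_act _ _ P) (@pair_coact _ _ P)) => //.
by move=> p; apply: submoduleN.
Qed.

Section PairTens.
Context {P : lie_pair N}.
Implicit Types (w : P) (n : N).

Lemma pair_tensDl w w' n :
  pair_tens (w + w') n = pair_tens w n + pair_tens w' n.
Proof. exact: tensDl. Qed.

Lemma pair_tensDr w n n' :
  pair_tens w (n + n') = pair_tens w n + pair_tens w n'.
Proof. exact: tensDr. Qed.

Lemma pair_tensZl k w n : pair_tens (k *: w) n = k *: pair_tens w n.
Proof. exact: tensZl. Qed.

Lemma pair_tensZr k w n : pair_tens w (k *: n) = k *: pair_tens w n.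
Proof. exact: tensZr. Qed.

Lemma pair_tens0l n : pair_tens (0 : P) n = 0.
Proof. by rewrite -(scale0r 0) pair_tensZl scale0r. Qed.

Lemma pair_tens0r w : pair_tens w 0 = 0.
Proof. by rewrite -(scale0r 0) pair_tensZr scale0r. Qed.

Lemma pair_tens_bracketr w n n' :
  pair_tens w [lie n, n']
  = pair_tens (pair_coact n' w) n - pair_tens (pair_coact n w) n'.
Proof. exact: tens_bracketr. Qed.

Lemma pair_tens_bracketl w w' n :
  pair_tens [lie w, w'] n
  = pair_tens w (pair_act w' n) - pair_tens w' (pair_act w n).
Proof. exact: tens_bracketl. Qed.

Lemma bracket_pair_tens w n w' n' :
  [lie pair_tens w n, pair_tens w' n']
  = - pair_tens (pair_coact n w) (pair_act w' n').
Proof. exact: bracket_tens. Qed.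

End PairTens.

Definition pair_nu (P : lie_pair N) : tensor_pair P -> N :=
  @tensor_nu _ _ _ (@pair_act _ _ P) (@pair_coact _ _ P).

Lemma tensor_crossed_module (P : lie_pair N) :
  is_crossed_module (@pair_nu P).
Proof.
have [[aP cP] compat] := (pair_act_lie P, pair_coact_lie P, pair_compatible P).
split=> //.
- exact: tensor_nu_linear aP compat.
- exact: tensor_nu_bracket aP compat.
- exact: tensor_act_nu.
Qed.

Lemma pair_nu_tens (P : lie_pair N) (w : P) n :
  pair_nu (pair_tens w n) = pair_act w n.
Proof. exact: tensor_nuE (pair_act_lie P) (pair_compatible P) w n. Qed.

(** The image of nu is spanned by the values ^w n = [lam w, n], that is, by the
    brackets with N of the term of the series that is the range of lam. It
    contains no more than the next term because that is a subalgebra. *)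
Lemma range_pair_nu (P : lie_pair N) (lam : P -> N) i :
    is_crossed_module lam -> range lam = gamma_ N i.+1 ->
  range (@pair_nu P) = gamma_ N i.+2.
Proof.
move=> lamP rlam; have [nul nub _ _] := tensor_crossed_module P.
apply/seteqP; split.
  move=> _ [t _ <-]; move: t; apply: pair_tens_generate.
    exact/(preimage_lie_subalgebra nul nub)/gamma_lie_subalgebra.
  move=> w n; rewrite /= pair_nu_tens (crossed_act lamP).
  by apply: gamma_bracket; rewrite -rlam; exists w.
apply: gammaS_sub.
  by case: (image_lie_subalgebra nul nub (@full_lie_subalgebra _ _)).
move=> x n; rewrite -rlam => -[w _ <-].
by exists (pair_tens w n); rewrite // pair_nu_tens (crossed_act lamP).
Qed.

(** * Finite generation of the tensor product *)

Section TensorSubalgebra.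
Context {P : lie_pair N}.
Variables (lam : P -> N) (S : set (tensor_pair P)).
Hypothesis lamP : is_crossed_module lam.
Hypothesis S_lie : is_lie_subalgebra S.

Let SM : is_submodule S := S_lie.1.
Let S0 : S 0. Proof. by have [] := SM. Qed.
Let SD p q : S p -> S q -> S (p + q). Proof. by have [_ + _] := SM; apply. Qed.
Let SZ k p : S p -> S (k *: p). Proof. by have [_ _ +] := SM; apply. Qed.
Let SN p : S p -> S (- p). Proof. exact: submoduleN. Qed.
Let SB p q : S p -> S q -> S (p - q). Proof. exact: submoduleB. Qed.

(** The Peiffer identity makes the kernel of nu central, so each argument of a
    bracket can be replaced by an element of S with the same image. *)
Lemma derived_sub_of_onto :
    range (@pair_nu P) `<=` @pair_nu P @` S ->
  forall p q : tensor_pair P, S [lie p, q].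
Proof.
move=> onto p q; have [_ _ _ peiffer] := tensor_crossed_module P.
have [|p' Sp' p'E] := onto (pair_nu p); first by exists p.
have [|q' Sq' q'E] := onto (pair_nu q); first by exists q.
rewrite -peiffer -p'E peiffer bracketC -peiffer -q'E peiffer -bracketC.
exact: S_lie.2.
Qed.

Hypothesis S_derived : forall p q : tensor_pair P, S [lie p, q].

(** For g = ^{w'} n' this is the relation
    [w (x) n, w' (x) n'] = - ^n w (x) ^{w'} n'. It propagates from such g to
    their brackets because expanding the right factor of ^n w (x) [g, g'] by
    the relation for w (x) [n, n'] again produces terms of the same form. *)
Lemma coact_tens_range_derived n w g :
  range (@pair_nu P) g -> S (pair_tens (pair_coact n w) g).
Proof.
have [nul nub _ _] := tensor_crossed_module P.
move=> [u _ <-]; move: u n w; apply: pair_tens_generate.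
  split; first split=> /=.
  - by move=> n w; rewrite (linear_0 nul) pair_tens0r.
  - move=> p q Sp Sq n w.
    by rewrite (linear_D nul) pair_tensDr; apply: SD.
  - by move=> k p Sp n w; rewrite (linear_Z nul) pair_tensZr; apply: SZ.
  - by move=> p q Sp Sq n w; rewrite nub pair_tens_bracketr; apply: SB.
move=> w' n' n w; rewrite /= pair_nu_tens -[pair_tens _ _]opprK.
by rewrite -bracket_pair_tens; apply: SN.
Qed.

(** Both reductions to generators work because their error terms have the form
    ^n w (x) g: this is visible in w (x) [g, g'] = ^{g'} w (x) g - ^g w (x) g',
    and the Peiffer identity gives [w, w'] (x) g = ^{lam w} w' (x) g. *)
Lemma tens_range_sub (W : seq P) (G : seq N) :
    [set: P] = smallest is_lie_subalgebra [set` W] ->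
    range (@pair_nu P) = smallest is_lie_subalgebra [set` G] ->
    (forall w g, w \in W -> g \in G -> S (pair_tens w g)) ->
  forall w g, range (@pair_nu P) g -> S (pair_tens w g).
Proof.
move=> WE GE SWG w; move: w (I : [set: P] w); rewrite WE; apply: smallest_sub.
  split; first split=> /=.
  - by move=> g _; rewrite pair_tens0l.
  - by move=> w w' Sw Sw' g rg; rewrite pair_tensDl; apply: SD; auto.
  - by move=> k w Sw g rg; rewrite pair_tensZl; apply: SZ; auto.
  - move=> w w' _ _ g rg; rewrite -(crossed_peiffer lamP).
    exact: coact_tens_range_derived.
move=> w wW g; rewrite GE => Gg.
(* The relation for w (x) [g, g'] is only usable when g and g' stay in the range
   of nu, so the induction carries this membership along. *)
have [[r0 rD rZ] rb] := smallest_lie_subalgebra [set` G].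
suff [] : (smallest is_lie_subalgebra [set` G]
            `&` [set g | S (pair_tens w g)]) g by [].
move: g Gg; apply: smallest_sub; last first.
  by move=> g gG; split; [apply: sub_gen_smallest | apply: SWG].
split; first split=> /=.
- by rewrite pair_tens0r.
- move=> x y [rx Sx] [ry Sy]; split; first exact: rD.
  by rewrite pair_tensDr; apply: SD.
- move=> k x [rx Sx]; split; first exact: rZ.
  by rewrite pair_tensZr; apply: SZ.
- move=> x y [rx Sx] [ry Sy]; split; first exact: rb.
  rewrite /= pair_tens_bracketr.
  by apply: SB => //; apply: coact_tens_range_derived; rewrite GE.
Qed.

(** Reducing the right factor to Y costs nothing, since the left factor is
    arbitrary. Reducing the left factor to W then leaves the terms
    w (x) ^{w'} y, whose right factor nu(w' (x) y) is in the range of nu. *)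
Lemma tensor_sub (W : seq P) (Y : seq N) :
    [set: P] = smallest is_lie_subalgebra [set` W] ->
    [set: N] = smallest is_lie_subalgebra [set` Y] ->
    (forall w y, w \in W -> y \in Y -> S (pair_tens w y)) ->
    (forall w g, range (@pair_nu P) g -> S (pair_tens w g)) ->
  forall t, S t.
Proof.
move=> WE YE SWY S_range; apply: pair_tens_generate => // w n.
move: n (I : [set: N] n) w; rewrite YE; apply: smallest_sub.
  split; first split=> /=.
  - by move=> w; rewrite pair_tens0r.
  - by move=> x y Sx Sy w; rewrite pair_tensDr; apply: SD.
  - by move=> k x Sx w; rewrite pair_tensZr; apply: SZ.
  - by move=> x y Sx Sy w; rewrite pair_tens_bracketr; apply: SB.
move=> y yY w; move: w (I : [set: P] w); rewrite WE.
apply: smallest_sub; last by move=> w wW; apply: SWY.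
split; first split=> /=.
- by rewrite pair_tens0l.
- by move=> w w' Sw Sw'; rewrite pair_tensDl; apply: SD.
- by move=> k w Sw; rewrite pair_tensZl; apply: SZ.
- move=> w w' _ _; rewrite pair_tens_bracketl.
  have range_act (v : P) x : range (@pair_nu P) (pair_act v x).
    by exists (pair_tens v x); rewrite // pair_nu_tens.
  by apply: SB; apply: S_range.
Qed.

End TensorSubalgebra.

Lemma tensor_fg (P : lie_pair N) (lam : P -> N) :
    is_crossed_module lam -> finitely_generated [set: N] ->
    finitely_generated [set: P] -> finitely_generated (range (@pair_nu P)) ->
  finitely_generated [set: tensor_pair P].
Proof.
move=> lamP [Y YE] [W WE] [G GE].
have [nul nub _ _] := tensor_crossed_module P.
have rG g : g \in G -> range (@pair_nu P) g.
  by move=> gG; rewrite GE; apply: sub_gen_smallest.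
have /boolp.choice[lift liftE] : forall g, exists t : tensor_pair P,
    g \in G -> pair_nu t = g.
  move=> g; have [/rG[t _ <-]|] := boolP (g \in G); first by exists t.
  by exists 0.
exists (map lift G ++ [seq pair_tens w y | w <- W, y <- Y]
                   ++ [seq pair_tens w g | w <- W, g <- G]).
set gens := _ ++ _; apply/seteqP; split=> // t _.
have S_lie := smallest_lie_subalgebra [set` gens].
set S := smallest _ _ in S_lie *.
have S_gen u : u \in gens -> S u by move=> ugens; apply: sub_gen_smallest.
have S_derived : forall p q : tensor_pair P, S [lie p, q].
  apply: (derived_sub_of_onto S_lie); rewrite GE; apply: smallest_sub.
    exact: (image_lie_subalgebra nul nub).
  move=> g gG; exists (lift g); last exact: liftE.
  by apply: S_gen; rewrite mem_cat map_f.
apply: (tensor_sub S_lie WE YE) => [w y wW yY|].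
  apply: S_gen; rewrite !mem_cat.
  by apply/or3P/Or32/allpairsP; exists (w, y).
apply: (tens_range_sub lamP S_lie S_derived WE GE) => w g wW gG.
apply: S_gen; rewrite !mem_cat.
by apply/or3P/Or33/allpairsP; exists (w, g).
Qed.

(** * The tensor powers *)

Lemma tensor_power_crossed_module i :
  exists2 lam : tensor_power N i.+1 -> N,
    is_crossed_module lam & range lam = gamma_ N i.+1.
Proof.
elim: i => [|i [lam lamP rlam]].
  by exists id; [exact: adjoint_crossed_module | rewrite image_id].
exists (@pair_nu (tensor_power N i.+1)); first exact: tensor_crossed_module.
exact: range_pair_nu lamP rlam.
Qed.

End CrossedModule.

Theorem theorem3p10 (K : fieldType) (m : lieAlgType K) (i : nat) :
  finitely_generated [set: m]%classic ->
  finitely_generated (gamma_ m i.+1) <->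
  finitely_generated [set: tensor_power m i.+1]%classic.
Proof.
move=> mfg; split; last first.
  have [lam [laml lamb _ _] <-] := tensor_power_crossed_module (N := m) i.
  exact: fg_range.
elim: i => [//|i IH] gfg.
have [lam lamP rlam] := tensor_power_crossed_module (N := m) i.
apply: (tensor_fg lamP) => //; first exact/IH/gamma_fg_pred.
by rewrite (range_pair_nu lamP rlam).
Qed.
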